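(* Let $X$ be a $q$-homogeneous tree with $q\ge 2$. For every $\alpha>1$ the Bergman projector $P_\alpha$ is of weak type $(1,1)$ with respect to $\mu_\alpha$; that is, there is a constant $C>0$ such that for every $f\in L^1_\alpha$ and every $\lambda>0$, $$\mu_\alpha(\{z\in X:|P_\alpha f(z)|>\lambda\})\le \frac{C}{\lambda}\|f\|_{L^1_\alpha}.$$
   Context: A $q$-homogeneous tree $X$ ($q\ge 2$ an integer) is an undirected connected cycle-free graph in which every vertex has exactly $q+1$ neighbours; $X$ also denotes its vertex set, $o\in X$ is a fixed origin and $|x|$ is the graph distance of $x$ from $o$. A function $f:X\to\mathbb{C}$ is harmonic if $f(v)=\frac1{q+1}\sum_{u\sim v}f(u)$ for every $v\in X$, where $u\sim v$ means adjacency. For $\alpha>1$, $\mu_\alpha$ is the finite measure on $X$ with density $\mu_\alpha(x)=q^{-\alpha|x|}$ with respect to the counting measure. $L^p_\alpha$ is the space of $f:X\to\mathbb{C}$ with $\|f\|_{L^p_\alpha}^p=\sum_{x\in X}|f(x)|^pq^{-\alpha|x|}<\infty$. $\mathcal{A}^2_\alpha$ is the Hilbert space of harmonic functions in $L^2_\alpha$ (scalar product $\sum_x f(x)\overline{g(x)}q^{-\alpha|x|}$), a reproducing kernel Hilbert space with reproducing kernel $K_\alpha:X\times X\to\mathbb{R}$: $K_\alpha(z,\cdot)\in\mathcal{A}^2_\alpha$ and $\sum_x g(x)K_\alpha(z,x)q^{-\alpha|x|}=g(z)$ for all $g\in\mathcal{A}^2_\alpha$, $z\in X$. The Bergman projector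 $P_\alpha$ is the orthogonal projection of $L^2_\alpha$ onto $\mathcal{A}^2_\alpha$; it is given by $P_\alpha f(z)=\sum_{x\in X}K_\alpha(z,x)f(x)q^{-\alpha|x|}$, and this formula (in which $K_\alpha(z,\cdot)$ is bounded for each fixed $z$) is used to define $P_\alpha f$ for $f\in L^1_\alpha$. *)

(* Defs.v *)
From HB Require Import structures.
From mathcomp Require Export all_boot all_order all_algebra.
From mathcomp Require Export all_classical all_reals all_analysis.
From mathcomp.real_closed Require Export complex.

Set Implicit Arguments.
Unset Strict Implicit.
Unset Printing Implicit Defensive.

Import Order.TTheory GRing.Theory Num.Theory.

Local Open Scope classical_set_scope.
Local Open Scope ring_scope.
Local Open Scope complex_scope.

(* A cycle is a duplicate-free cyclic sequence of at least three vertices: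
   shorter ones only go back and forth along an edge. *)
Record homogeneous_tree (q : nat) := HomogeneousTree {
  vertex :> choiceType;
  adj : rel vertex;
  adj_sym : symmetric adj;
  adj_irr : irreflexive adj;
  adj_connected : forall x y : vertex, exists2 p, path adj x p & last x p = y;
  adj_acyclic : forall c : seq vertex, ucycle adj c -> (size c < 3)%N;
  adj_degree : forall x : vertex, ([set y | adj x y] #= `I_q.+1)%card }.

Section Distance.
Variables (q : nat) (X : homogeneous_tree q).

Definition joined_by (x y : X) (n : nat) : Prop :=
  exists p, [/\ path (@adj q X) x p, last x p = y & size p = n].

Lemma joined_by_some (x y : X) : exists n, `[< joined_by x y n >].
Proof.
by have [p pP pl] := adj_connected x y; exists (size p); apply/asboolP; exists p.
Qed.

Definition dist (x y : X) : nat := ex_minn (joined_by_some x y).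

End Distance.

Section Bergman.
Variables (R : realType) (q : nat) (X : homogeneous_tree q) (o : X).

Definition cmod (z : R[i]) : R := complex.Re `|z|.

Definition harmonic (f : X -> R[i]) : Prop :=
  forall v : X, f v = (q.+1%:R)^-1 * \sum_(u \in [set u | adj v u]) f u.

Definition weight (alpha : R) (x : X) : R := q%:R `^ (- alpha * (dist o x)%:R).

Definition mu (alpha : R) (A : set X) : \bar R :=
  (\esum_(x in A) (weight alpha x)%:E)%E.

(* The p-th power of the L^p norm; for p = 1 this is the norm itself. *)
Definition Lp_powernorm (alpha p : R) (f : X -> R[i]) : \bar R :=
  (\esum_(x in [set: X]) (cmod (f x) `^ p * weight alpha x)%:E)%E.

Definition in_Lp (alpha p : R) (f : X -> R[i]) : Prop :=
  (Lp_powernorm alpha p f < +oo)%E.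

Definition in_A2 (alpha : R) (f : X -> R[i]) : Prop :=
  harmonic f /\ in_Lp alpha 2 f.

(* Sums of absolutely summable families over X; the value is meaningless
   for other families. *)
Definition rsum (a : X -> R) : R :=
  fine (\esum_(x in [set: X]) (a^\+ x)%:E)%E
  - fine (\esum_(x in [set: X]) (a^\- x)%:E)%E.

Definition csum (a : X -> R[i]) : R[i] :=
  rsum (fun x => complex.Re (a x)) +i* rsum (fun x => complex.Im (a x)).

(* The families summed here are absolutely summable: by Cauchy-Schwarz in the
   reproducing identity, and in [bergman_projector] because f is in L^1 and the
   kernel is bounded in its second variable. *)
Definition reproducing_kernel (alpha : R) (K : X -> X -> R) : Prop :=
  (forall z, in_A2 alpha (fun x => (K z x)%:C)) /\
  (forall g z, in_A2 alpha g ->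
     csum (fun x => g x * (K z x)%:C * (weight alpha x)%:C) = g z).

(* The definite description of the reproducing kernel, which exists (point
   evaluations are bounded on the real and complex harmonic L^2 functions) and
   is unique; the default value 0 is never reached when 1 < alpha. *)
Definition bergman_kernel (alpha : R) : X -> X -> R :=
  xget (fun _ _ => 0) [set K | reproducing_kernel alpha K].

Definition bergman_projector (alpha : R) (f : X -> R[i]) (z : X) : R[i] :=
  csum (fun x => (bergman_kernel alpha z x)%:C * f x * (weight alpha x)%:C).

End Bergman.

(* Main.v *)
Require Import Defs.
From mathcomp Require Import ring lra.

Set Implicit Arguments.
Unset Strict Implicit.
Unset Printing Implicit Defensive.

Import Order.TTheory GRing.Theory Num.Theory.
Import numFieldNormedType.Exports.

(** Why the projector is of weak type (1,1).

    The kernel is computed first. Write [b = q^alpha], so that a vertex [x] has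
    weight [b^-|x|], and call sector of [v] the set of descendants of [v]. The
    square-integrable harmonic functions split orthogonally into the constants
    and, for every vertex [v], the harmonic functions that live on the sector of
    [v], vanish at [v] and are radial on the sector of each son of [v]; such a
    function is given by one coefficient per son, the coefficients adding up to
    zero. The kernel of each piece is explicit, and summing over the ancestors
    of [z] gives the finite formula [explicit_kernel]. Rather than proving that
    the decomposition is complete, the reproducing identity is checked
    directly: the mean value property on spheres inside a sector
    ([sum_level_harmonic]) turns the pairing of [u] with the piece at [v] into a
    second difference of [u] along the path from the origin to [z], and these
    second differences telescope to [u z - u o] ([sum_radial_excess],
    [cvg_explicit_kernel]). A reproducing kernel is unique, so this is the
    Bergman kernel ([bergman_kernelE]).

    The formula shows that the kernel at [(z, x)] is at most a constant times
    the sum of [b^|v|] over the common ancestors [v] of [z] and [x]. Since the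
    mass of the sector of [v] is comparable to [b^-|v|], the projection of [f]
    at [z] is dominated by the sum, over the ancestors [v] of [z], of the
    averages of [|f|] over the sectors of the [v]
    ([cmod_projector_le]). No cancellation is used after that point.

    It remains to see that this sum of averages is of weak type (1,1)
    ([level_set_mass_le]), which is done by an induction in the style of
    Bellman functions. In the sector of [v], with average [t], the mass of the
    points where the averages from [v] on add up to more than [l] is claimed to
    be at most [C w(v) t / (l + a t)]. Passing to the sons replaces [l] by
    [l - t]; by concavity in [t] the worst case is that of equal averages on
    the [q] sons, each at most [b / q * t], and then the claim reproduces itself
    exactly when [a * (b / q - 1) = 1]. This is where [alpha > 1], that is
    [b > q], enters. *)

Local Open Scope classical_set_scope.
Local Open Scope ring_scope.

(** * Geometry of the rooted tree *)

Section Walks.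
Variables (q : nat) (X : homogeneous_tree q).
Implicit Types (x y z : X) (p s : seq X).

Fixpoint nonbacktracking s : bool :=
  if s is x :: s' then
    (if s' is y :: z :: _ then x != z else true) && nonbacktracking s'
  else true.

Definition nb_walk s := sorted (@adj q X) s && nonbacktracking s.

(** A repeated vertex closes up a cycle, and taking the first return to the head
    of the shortest offending suffix makes it simple; irreflexivity and absence
    of backtracking give it at least three vertices. This is the only use of
    acyclicity. *)
Lemma nb_walk_uniq s : nb_walk s -> uniq s.
Proof.
rewrite /nb_walk; elim: s => //= x s IHs /andP[adj_s /andP[nb_x nb_s]].
have us : uniq s by rewrite IHs // nb_s (path_sorted adj_s).
rewrite us andbT; apply/negP => xs.
case/splitPr: xs us adj_s nb_x {IHs nb_s} => p1 p2 us adj_s nb_x.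
have ucyc : ucycle (@adj q X) (x :: p1).
  rewrite /ucycle /= rcons_path; move: adj_s; rewrite cat_path /=.
  case/and3P=> -> -> _ /=; move: us; rewrite cat_uniq /= negb_or.
  by case/and3P=> -> /andP[-> _] _.
have := adj_acyclic ucyc.
case: p1 {us ucyc} adj_s nb_x => [|y [|z p1]] //=.
  by rewrite adj_irr.
by rewrite eqxx.
Qed.

End Walks.

Section Tree.
Variables (q : nat) (X : homogeneous_tree q) (o : X).
Implicit Types (v x y z : X) (p s : seq X).

Local Notation d := (dist o).

Lemma dist_path x p : path (@adj q X) x p -> (dist x (last x p) <= size p)%N.
Proof.
move=> adj_p; rewrite /dist; case: ex_minnP => n _; apply.
by apply/asboolP; exists p.
Qed.

Lemma dist_geodesic x y :
  exists p, [/\ path (@adj q X) x p, last x p = y & size p = dist x y].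
Proof. by rewrite /dist; case: ex_minnP => n /asboolP. Qed.

Lemma dist_origin : d o = 0%N.
Proof. by apply/eqP; rewrite -leqn0; exact: (@dist_path o [::]). Qed.

Lemma dist_eq0 x : (d x == 0%N) = (x == o).
Proof.
apply/eqP/eqP => [|->]; last exact: dist_origin.
by have [[|y p] [_ /= ? <-]] := dist_geodesic o x.
Qed.

Lemma closer_neighbour x : x != o -> exists2 y, adj x y & d x = (d y).+1.
Proof.
have [p [adj_p lp sp]] := dist_geodesic o x.
case/lastP: p adj_p lp sp => [_ /= <-|p z]; first by rewrite eqxx.
rewrite rcons_path last_rcons size_rcons => /andP[adj_p adj_z] zx sp _.
rewrite {}zx in adj_z; exists (last o p); first by rewrite adj_sym.
apply/eqP; rewrite eqn_leq -{2}sp ltnS dist_path // andbT.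
have [r [adj_r lr sr]] := dist_geodesic o (last o p).
rewrite -sr -(size_rcons r x).
have := @dist_path o (rcons r x); rewrite last_rcons; apply.
by rewrite rcons_path adj_r lr.
Qed.

Let closer := [rel x y : X | adj x y && (d x == (d y).+1)].

Lemma descent x : exists2 p, path closer x p & last x p = o.
Proof.
have [n] := ubnP (d x); elim: n x => // n IHn x; rewrite ltnS => dxn.
have [->|/closer_neighbour[y adj_xy dxy]] := eqVneq x o; first by exists [::].
have [|p closer_p lp] := IHn y; first by rewrite -dxy.
by exists (y :: p) => //=; rewrite adj_xy dxy eqxx.
Qed.

Lemma nb_walk_descent x z p : adj x z -> (d z <= d x)%N -> path closer z p ->
  nb_walk (x :: z :: p).
Proof.
rewrite /nb_walk; elim: p x z => [|t p IHp] x z adj_xz dzx /=.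
  by rewrite adj_xz.
case/andP=> /andP[adj_zt /eqP dzt] closer_p.
have := IHp z t adj_zt; rewrite dzt leqnSn => /(_ isT closer_p) /= /andP[-> ->].
rewrite adj_xz /= andbT; apply/eqP => xt.
by move: dzx; rewrite dzt xt ltnn.
Qed.

(** [catrev] prepends the reversed descent, so that the walk climbs from the end
    of [p] to [y] before it continues with [x]. *)
Lemma nb_walk_ascent x y p s : path closer y p -> (d y <= d x)%N ->
  nb_walk (y :: x :: s) -> nb_walk (catrev (y :: p) (x :: s)).
Proof.
elim: p x y s => [|t p IHp] x y s //=.
case/andP=> /andP[adj_yt /eqP dyt] closer_p dyx nb_s.
have /= := IHp y t (x :: s) closer_p; apply; first by rewrite dyt.
move: nb_s; rewrite /nb_walk /= => /andP[-> ->].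
rewrite adj_sym adj_yt /= andbT; apply/eqP => tx.
by move: dyx; rewrite dyt tx ltnn.
Qed.

(** Otherwise going from the origin up to [x] through [y] and down again through
    [z] is a walk without backtracking that visits the origin twice. *)
Lemma closer_neighbour_unique x y z : adj x y -> adj x z ->
  (d y <= d x)%N -> (d z <= d x)%N -> y = z.
Proof.
move=> adj_xy adj_xz dyx dzx; apply/eqP/negPn/negP => yz.
have [p closer_p lp] := descent y; have [r closer_r lr] := descent z.
have nb_xz := nb_walk_descent adj_xz dzx closer_r.
have /nb_walk_uniq : nb_walk (catrev (y :: p) (x :: z :: r)).
  apply: nb_walk_ascent => //; move: nb_xz; rewrite /nb_walk /= yz.
  by rewrite (adj_sym y x) adj_xy.
rewrite catrevE cat_uniq => /and3P[_ /hasPn/(_ o) + _].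
by rewrite mem_rev -{2}lp mem_last inE -{2}lr mem_last orbT => /(_ isT).
Qed.

Definition neighbours x : seq X := finmap.enum_fset (fset_set [set y | adj x y]).

Lemma finite_neighbours x : finite_set [set y | adj x y].
Proof. by apply/finite_setP; exists q.+1; exact: adj_degree. Qed.

Lemma mem_neighbours x y : (y \in neighbours x) = adj x y.
Proof.
by rewrite in_fset_set ?inE; [apply/asboolP/idP|exact: finite_neighbours].
Qed.

Lemma size_neighbours x : size (neighbours x) = q.+1.
Proof. exact: card_fset_set (adj_degree x). Qed.

Definition sons x : seq X := [seq y <- neighbours x | (d x < d y)%N].

(** The origin is its own parent: this makes ancestors total and lets
    harmonicity be written without treating the origin apart. *)
Definition parent x : X :=
  if x == o then o else head o [seq y <- neighbours x | (d y < d x)%N].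

Lemma parent_origin : parent o = o.
Proof. by rewrite /parent eqxx. Qed.

Lemma adj_parent x : x != o -> adj x (parent x).
Proof.
move=> xo; rewrite /parent (negbTE xo).
have [y adj_xy dxy] := closer_neighbour xo.
case E : [seq _ <- _ | _] => [|z s] /=.
  suff: y \in [::] by [].
  by rewrite -E mem_filter mem_neighbours adj_xy dxy ltnS leqnn.
by have := mem_head z s; rewrite -E mem_filter mem_neighbours => /andP[].
Qed.

Lemma dist_parent x : d (parent x) = (d x).-1.
Proof.
have [->|xo] := eqVneq x o; first by rewrite parent_origin dist_origin.
have := adj_parent xo; rewrite /parent (negbTE xo).
have [y adj_xy dxy] := closer_neighbour xo.
case E : [seq _ <- _ | _] => [|z s] /= adj_xz.
  suff: y \in [::] by [].
  by rewrite -E mem_filter mem_neighbours adj_xy dxy ltnS leqnn.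
have /andP[dzx _] : (d z < d x)%N && (z \in neighbours x).
  by have := mem_head z s; rewrite -E mem_filter.
by rewrite (@closer_neighbour_unique x z y) ?(ltnW dzx) ?dxy.
Qed.

Lemma dist_gt0 x : (0 < d x)%N = (x != o).
Proof. by rewrite lt0n dist_eq0. Qed.

Lemma dist_parentS x : x != o -> (d (parent x)).+1 = d x.
Proof. by move=> xo; rewrite dist_parent prednK // dist_gt0. Qed.

Lemma parent_unique x y : adj x y -> (d y <= d x)%N -> y = parent x.
Proof.
move=> adj_xy dyx; have [xo|xo] := eqVneq x o.
  move: dyx; rewrite xo dist_origin leqn0 dist_eq0 => /eqP yo.
  by rewrite xo yo adj_irr in adj_xy.
apply: closer_neighbour_unique adj_xy (adj_parent xo) dyx _.
by rewrite -(dist_parentS xo).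
Qed.

Lemma mem_sons x y : (y \in sons x) = (y != o) && (parent y == x).
Proof.
rewrite mem_filter mem_neighbours; apply/andP/andP => [[dxy adj_xy]|[yo /eqP<-]].
  rewrite -dist_gt0 (leq_ltn_trans _ dxy) //; split=> //.
  by rewrite (@parent_unique y x) ?(ltnW dxy) // adj_sym.
by rewrite dist_parent adj_sym adj_parent // prednK ?dist_gt0.
Qed.

Lemma uniq_sons x : uniq (sons x).
Proof. exact/filter_uniq/finmap.fset_uniq. Qed.

Lemma neighbours_origin : perm_eq (neighbours o) (sons o).
Proof.
apply: uniq_perm (finmap.fset_uniq _) (uniq_sons _) _ => y.
rewrite mem_filter mem_neighbours andb_idl // => adj_oy.
by rewrite dist_origin dist_gt0; apply/eqP => yo; rewrite yo adj_irr in adj_oy.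
Qed.

Lemma neighbours_parent x : x != o ->
  perm_eq (neighbours x) (parent x :: sons x).
Proof.
move=> xo; apply: uniq_perm (finmap.fset_uniq _) _ _.
  rewrite /= uniq_sons andbT mem_filter negb_and -leqNgt.
  by rewrite -(dist_parentS xo) leqnSn.
move=> y; rewrite inE mem_filter !mem_neighbours.
apply/idP/orP => [adj_xy|[/eqP->|/andP[]//]]; last exact: adj_parent.
have [dxy|dyx] := ltnP (d x) (d y); first by right; rewrite adj_xy.
by left; rewrite (parent_unique adj_xy).
Qed.

Lemma size_sons_origin : size (sons o) = q.+1.
Proof. by rewrite -(perm_size neighbours_origin) size_neighbours. Qed.

Lemma size_sons x : x != o -> size (sons x) = q.
Proof.
move=> /neighbours_parent/perm_size; rewrite size_neighbours.
by move=> /eqP; rewrite eqSS => /eqP.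
Qed.

Lemma dist_iter_parent k x : d (iter k parent x) = (d x - k)%N.
Proof. by elim: k => [|k IHk]; rewrite ?subn0 //= dist_parent IHk subnS. Qed.

Lemma iter_parent_dist x : iter (d x) parent x = o.
Proof. by apply/eqP; rewrite -dist_eq0 dist_iter_parent subnn. Qed.

(** Truncated subtraction makes this false when [x] is closer to the origin
    than [v]: then the left-hand side is [x] itself. *)
Definition descends v x := iter (d x - d v) parent x == v.

Lemma descends_refl x : descends x x.
Proof. by rewrite /descends subnn. Qed.

Lemma descends_origin x : descends o x.
Proof. by rewrite /descends dist_origin subn0 iter_parent_dist. Qed.

Lemma descends_dist v x : descends v x -> (d v <= d x)%N.
Proof. by move=> /eqP <-; rewrite dist_iter_parent leq_subr. Qed.

Lemma descends_son v x : x != o ->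
  descends v x = descends v (parent x) || (x == v).
Proof.
move=> xo; have [dvp|dpv] := leqP (d v) (d (parent x)).
  rewrite {1}/descends -(dist_parentS xo) subSn // iterSr orbC.
  by case: (eqVneq x v) => // xv; move: dvp; rewrite -xv -(dist_parentS xo) ltnn.
rewrite {1}/descends -(dist_parentS xo).
have -> : ((d (parent x)).+1 - d v = 0)%N by apply/eqP; rewrite subn_eq0.
rewrite /= orb_idl // => /descends_dist.
by rewrite leqNgt dpv.
Qed.

Lemma descends_parent y x : y != o -> descends y x -> descends (parent y) x.
Proof.
move=> yo desc_yx; have dyx := descends_dist desc_yx.
rewrite /descends -{1}(prednK (n := d x - d (parent y))); last first.
  by rewrite subn_gt0 (leq_trans _ dyx) // -(dist_parentS yo).
by rewrite -subnS (dist_parentS yo) iterS (eqP desc_yx).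
Qed.

Fixpoint level k v : seq X :=
  if k is k'.+1 then flatten [seq level k' y | y <- sons v] else [:: v].

Lemma mem_level k v x : (x \in level k v) = (d x == d v + k)%N && descends v x.
Proof.
elim: k v x => [|k IHk] v x /=.
  rewrite inE addn0; apply/eqP/andP => [->|[/eqP dxv]].
    by rewrite descends_refl.
  by rewrite /descends dxv subnn => /eqP.
apply/flatten_mapP/andP => [[y]|[/eqP dx desc_vx]].
  rewrite mem_sons IHk => /andP[yo /eqP<-] /andP[/eqP-> /(descends_parent yo)->].
  by rewrite -(dist_parentS yo) addSnnS.
have dxk : (d x - k = (d v).+1)%N by rewrite dx addnS -addSn addnK.
exists (iter k parent x).
  rewrite mem_sons -dist_gt0 dist_iter_parent dxk /=.
  by move: desc_vx; rewrite -iterS /descends dx addKn.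
rewrite IHk dist_iter_parent dxk addSn dx addnS eqxx.
by rewrite /descends dist_iter_parent dxk dx addnS -addSn addKn eqxx.
Qed.

Lemma uniq_level k v : uniq (level k v).
Proof.
elim: k v => //= k IHk v.
have same_parent y z : y \in sons v -> z \in sons v -> d y = d z.
  rewrite !mem_sons => /andP[yo /eqP yv] /andP[zo /eqP zv].
  by rewrite -(dist_parentS yo) -(dist_parentS zo) yv zv.
have: {subset sons v <= sons v} by [].
elim: {-3}(sons v) (uniq_sons v) => //= y s IHs /andP[ys us] s_sons.
have {}IHs : uniq (flatten [seq level k y | y <- s]).
  by apply: IHs => // z zs; apply: s_sons; rewrite inE zs orbT.
rewrite cat_uniq IHk IHs andbT /=; apply/hasPn => x /flatten_mapP[z zs].
rewrite !mem_level => /andP[/eqP dx /eqP xz]; apply/andP => -[_ /eqP xy].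
have dyz : d y = d z.
  by apply: same_parent; apply: s_sons; rewrite inE ?eqxx // zs orbT.
by move: ys; rewrite -xy dyz xz zs.
Qed.

End Tree.

(** * Sums over the tree as limits of sums over balls *)
Section LevelSums.
Variables (R : realType) (q : nat) (X : homogeneous_tree q) (o : X).
Implicit Types (v x y : X) (h a u : X -> R).

Local Notation d := (dist o).

Definition partial_sum n h v : R := \sum_(k < n) \sum_(x <- level o k v) h x.

Lemma sum_levelS k v h :
  \sum_(x <- level o k.+1 v) h x
  = \sum_(y <- sons o v) \sum_(x <- level o k y) h x.
Proof. by rewrite big_flatten big_map. Qed.

Lemma partial_sum_recl n h v :
  partial_sum n.+1 h v = h v + \sum_(y <- sons o v) partial_sum n h y.
Proof.
rewrite /partial_sum big_ord_recl /= big_seq1 exchange_big /=; congr (_ + _).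
by apply: eq_bigr => k _; rewrite sum_levelS.
Qed.

Lemma partial_sum_recr n h v :
  partial_sum n.+1 h v = partial_sum n h v + \sum_(x <- level o n v) h x.
Proof. exact: big_ord_recr. Qed.

Lemma eq_partial_sum n h1 h2 v :
  h1 =1 h2 -> partial_sum n h1 v = partial_sum n h2 v.
Proof. by move=> h12; apply: eq_bigr => k _; apply: eq_bigr. Qed.

Lemma le_partial_sum n h1 h2 v :
  (forall x, h1 x <= h2 x) -> partial_sum n h1 v <= partial_sum n h2 v.
Proof. by move=> h12; apply: ler_sum => k _; apply: ler_sum. Qed.

Lemma partial_sum_ge0 n h v : (forall x, 0 <= h x) -> 0 <= partial_sum n h v.
Proof. by move=> h0; apply: sumr_ge0 => k _; apply: sumr_ge0. Qed.

Lemma partial_sumD n h1 h2 v :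
  partial_sum n (fun x => h1 x + h2 x) v
  = partial_sum n h1 v + partial_sum n h2 v.
Proof. by rewrite -big_split; apply: eq_bigr => k _; rewrite big_split. Qed.

Lemma partial_sumZ n c h v :
  partial_sum n (fun x => c * h x) v = c * partial_sum n h v.
Proof. by rewrite mulr_sumr; apply: eq_bigr => k _; rewrite mulr_sumr. Qed.

Lemma partial_sum_sum n I (r : seq I) (F : I -> X -> R) v :
  partial_sum n (fun x => \sum_(i <- r) F i x) v
  = \sum_(i <- r) partial_sum n (F i) v.
Proof.
rewrite /partial_sum exchange_big; apply: eq_bigr => k _.
by rewrite exchange_big.
Qed.

Lemma partial_sum_nondecreasing h v : (forall x, 0 <= h x) ->
  nondecreasing_seq (fun n => partial_sum n h v).
Proof.
move=> h0; apply/nondecreasing_seqP => n.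
by rewrite partial_sum_recr lerDl; apply: sumr_ge0.
Qed.

(** The indicator of a sector turns sums about the origin into sums about the
    vertex of the sector, which are the ones that obey a recursion. *)
Lemma sum_level_descends k v h :
  \sum_(x <- level o k o) (descends o v x)%:R * h x
  = if (k < d v)%N then 0 else \sum_(x <- level o (k - d v) v) h x.
Proof.
under eq_bigr do rewrite mulr_natl mulrb.
rewrite -big_mkcond /= -big_filter; case: ltnP => [kv|vk].
  rewrite big1_seq // => x /andP[_]; rewrite mem_filter mem_level.
  case/and3P=> /descends_dist + /eqP dx _.
  by rewrite dx dist_origin add0n leqNgt kv.
apply: perm_big; apply: uniq_perm (filter_uniq _ _) _ _; rewrite ?uniq_level //.
move=> x; rewrite mem_filter !mem_level dist_origin add0n subnKC //.
by rewrite descends_origin andbT andbC.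
Qed.

Lemma partial_sum_descends n v h :
  partial_sum n (fun x => (descends o v x)%:R * h x) o
  = partial_sum (n - d v) h v.
Proof.
elim: n => [|n IHn]; first by rewrite /partial_sum !big_ord0.
rewrite partial_sum_recr IHn sum_level_descends; case: ltnP => [nv|vn].
  rewrite addr0 (eqP (_ : (n.+1 - d v)%N == 0%N)) ?subn_eq0 //.
  by rewrite (eqP (_ : (n - d v)%N == 0%N)) // subn_eq0 ltnW.
by rewrite subSn // partial_sum_recr.
Qed.

Definition ball n : seq X := flatten [seq level o k o | k <- iota 0 n].

Lemma sum_ball n h : \sum_(x <- ball n) h x = partial_sum n h o.
Proof.
by rewrite big_flatten big_map -[n in iota 0 n]subn0 -/(index_iota 0 n) big_mkord.
Qed.

Lemma mem_ball n x : (x \in ball n) = (d x < n)%N.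
Proof.
apply/flatten_mapP/idP => [[k]|dxn].
  by rewrite mem_iota mem_level dist_origin => /andP[_ kn] /andP[/eqP-> _].
by exists (d x); rewrite ?mem_iota // mem_level descends_origin dist_origin eqxx.
Qed.

Lemma uniq_ball n : uniq (ball n).
Proof.
elim: n => // n IHn; rewrite /ball -addn1 iotaD map_cat flatten_cat cat_uniq.
rewrite -/(ball n) IHn /= cats0 uniq_level andbT; apply/hasPn => x.
rewrite mem_level dist_origin => /andP[/eqP dx _].
by rewrite mem_ball dx ltnn.
Qed.

Lemma partial_sum_le_esum n h : (forall x, 0 <= h x) ->
  ((partial_sum n h o)%:E <= \esum_(x in [set: X]) (h x)%:E)%E.
Proof.
move=> h0; apply: esum_ge; exists [set` ball n]; first by split.
by rewrite -fsbig_seq ?uniq_ball // -sum_ball sumEFin.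
Qed.

Lemma esum_le_partial_sum h (M : R) : (forall x, 0 <= h x) ->
  (forall n, partial_sum n h o <= M) ->
  (\esum_(x in [set: X]) (h x)%:E <= M%:E)%E.
Proof.
move=> h0 hM; apply: ge_ereal_sup => _ [A [finA _] <-].
pose n := \max_(x <- finmap.enum_fset (fset_set A)) (d x).+1.
apply: (@le_trans _ _ (partial_sum n h o)%:E); last by rewrite lee_fin.
rewrite -sum_ball -sumEFin (fsbig_seq _ _ (uniq_ball n)).
apply: lee_fsum_nneg_subset => // [x Ax|x _]; last by rewrite lee_fin.
rewrite inE /= mem_ball /n.
by apply: leq_bigmax_seq => //; rewrite in_fset_set.
Qed.

Definition bounded_sums a := exists M, forall n,
  partial_sum n (fun x => `|a x|) o <= M.

Lemma cvg_partial_sum_ge0 h : (forall x, 0 <= h x) -> bounded_sums h ->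
  partial_sum n h o @[n --> \oo] --> fine (\esum_(x in [set: X]) (h x)%:E).
Proof.
move=> h0 [M hM].
have {}hM n : partial_sum n h o <= M.
  by rewrite (le_trans _ (hM n)) // le_partial_sum // => x; exact: ler_norm.
have nd := @partial_sum_nondecreasing h o h0.
have ub : has_ubound (range (fun n => partial_sum n h o)).
  by exists M => _ [n _ <-].
have cv := nondecreasing_cvgn nd ub.
suff -> : \esum_(x in [set: X]) (h x)%:E
          = (sup (range (fun n => partial_sum n h o)))%:E by [].
apply/eqP; rewrite eq_le; apply/andP; split.
  by apply: esum_le_partial_sum => // n; apply: ub_le_sup.
have := esum_le_partial_sum h0 hM.
have := fun n => partial_sum_le_esum n h0.
case: (esum _ _) => [r| |] //=; last by move=> /(_ 0%N).
move=> rP _; rewrite lee_fin; apply: ge_sup; first by exists (partial_sum 0 h o), 0%N.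
by move=> _ [n _ <-]; rewrite -lee_fin.
Qed.

(** All sums over the tree are handled through this limit: unlike [rsum], which
    splits [a] into positive and negative parts, sums over balls are visibly
    linear in [a]. *)
Lemma cvg_partial_sum a : bounded_sums a ->
  partial_sum n a o @[n --> \oo] --> rsum a.
Proof.
move=> [M aM]; have aE x : a x = a^\+ x + -1 * a^\- x.
  by rewrite mulN1r -[in LHS](funrposBneg a).
have pE x : `|a x| = a^\+ x + a^\- x by rewrite -[LHS]/((Num.norm \o a) x) -funrposDneg.
have -> : (fun n => partial_sum n a o)
          = (fun n => partial_sum n a^\+ o - partial_sum n a^\- o).
  apply/funext => n; rewrite (eq_partial_sum _ _ aE) partial_sumD partial_sumZ.
  by rewrite mulN1r.
apply: cvgB; apply: cvg_partial_sum_ge0 => [x|]; rewrite ?funrpos_ge0 ?funrneg_ge0 //;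
  exists M => n; apply: le_trans (aM n); apply: le_partial_sum => x;
  by rewrite pE ger0_norm ?funrpos_ge0 ?funrneg_ge0 // ?lerDl ?lerDr
             ?funrpos_ge0 ?funrneg_ge0.
Qed.

Lemma rsum_eq a l : bounded_sums a ->
  partial_sum n a o @[n --> \oo] --> l -> rsum a = l.
Proof. by move=> /cvg_partial_sum; apply: cvg_unique. Qed.

Lemma norm_rsum_le a (M : R) :
  (forall n, partial_sum n (fun x => `|a x|) o <= M) -> `|rsum a| <= M.
Proof.
move=> aM; have /cvg_partial_sum/cvg_norm aS : bounded_sums a by exists M.
apply: (cvgr_to_le aS); near=> n; apply: le_trans (aM n).
rewrite (le_trans (ler_norm_sum _ _ _)) //; apply: ler_sum => k _.
exact: ler_norm_sum.
Unshelve. all: by end_near.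
Qed.

End LevelSums.

(** * Weights and spherical means of harmonic functions *)
Section Kernel.
Variables (R : realType) (q : nat) (X : homogeneous_tree q) (o : X) (alpha : R).
Hypotheses (hq : (2 <= q)%N) (halpha : 1 < alpha).
Implicit Types (v x y z : X) (u : X -> R).

Local Notation d := (dist o).
Local Notation w := (weight o alpha).
Local Notation Q := (q%:R : R).

(** One step away from the origin divides the weight by this factor. *)
Definition growth : R := Q `^ alpha.
Local Notation b := growth.

Lemma Q_ge2 : 2 <= Q. Proof. by rewrite ler_nat. Qed.

Lemma Q_gt0 : 0 < Q. Proof. exact: lt_le_trans Q_ge2. Qed.

Lemma growth_gtQ : Q < b.
Proof.
have a0 : 0 < alpha - 1 by rewrite subr_gt0.
rewrite /growth -mulr_powRB1 ?(ltW Q_gt0) ?(lt_trans _ halpha) //.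
have one : 1 `^ (alpha - 1) = 1 :> R by rewrite powR1.
rewrite ltr_pMr ?Q_gt0 // -[ltLHS]one.
apply: gt0_ltr_powR => //; rewrite ?nnegrE ?(ltW Q_gt0) //.
by rewrite ltr1n.
Qed.

Lemma growth_gt0 : 0 < b. Proof. exact: lt_trans Q_gt0 growth_gtQ. Qed.

Lemma weightE x : w x = b ^- d x.
Proof.
rewrite /weight mulNr powRN powRrM powR_mulrn ?powR_ge0 //.
Qed.

Lemma weight_gt0 x : 0 < w x.
Proof. by rewrite weightE invr_gt0 exprn_gt0 ?growth_gt0. Qed.

Lemma weight_son v y : y \in sons o v -> w y = w v / b.
Proof.
rewrite mem_sons => /andP[yo /eqP <-].
by rewrite !weightE -(dist_parentS yo) exprS invfM mulrC.
Qed.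

(** The sum of the geometric series of ratio [q / b], which is the mass of a
    sector divided by the weight of its vertex. *)
Definition sector_ratio : R := b / (b - Q).
Local Notation c := sector_ratio.

Lemma sector_ratio_gt0 : 0 < c.
Proof. by rewrite divr_gt0 ?growth_gt0 ?subr_gt0 ?growth_gtQ. Qed.

Lemma sector_ratioE : 1 + Q / b * c = c.
Proof.
have bQ : b - Q != 0 by rewrite subr_eq0 gt_eqF ?growth_gtQ.
have b0 : b != 0 by rewrite gt_eqF ?growth_gt0.
by rewrite /sector_ratio; field; rewrite b0 bQ.
Qed.

Lemma sector_mass_le n v : v != o -> partial_sum o n w v <= c * w v.
Proof.
elim: n v => [|n IHn] v vo.
  by rewrite /partial_sum big_ord0 mulr_ge0 ?ltW ?sector_ratio_gt0 ?weight_gt0.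
rewrite partial_sum_recl -[X in _ <= X * _]sector_ratioE mulrDl mul1r lerD2l.
apply: (@le_trans _ _ (\sum_(y <- sons o v) c * (w v / b))).
  rewrite big_seq [leRHS]big_seq; apply: ler_sum => y ysons.
  rewrite -(weight_son ysons) IHn //.
  by move: ysons; rewrite mem_sons => /andP[].
rewrite big_const_seq count_predT iter_addr_0 size_sons //.
by rewrite -[leLHS]mulr_natl le_eqVlt; apply/orP; left; apply/eqP; ring.
Qed.

Lemma total_mass_bounded : exists M, forall n, partial_sum o n w o <= M.
Proof.
exists (w o + \sum_(y <- sons o o) c * w y) => -[|n].
  rewrite /partial_sum big_ord0; apply: addr_ge0; first exact/ltW/weight_gt0.
  by apply: sumr_ge0 => y _; rewrite mulr_ge0 ?ltW ?sector_ratio_gt0 ?weight_gt0.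
rewrite partial_sum_recl lerD2l big_seq [leRHS]big_seq; apply: ler_sum => y.
by rewrite mem_sons => /andP[yo _]; exact: sector_mass_le.
Qed.

Definition total_mass : R := limn (fun n => partial_sum o n w o).
Local Notation M := total_mass.

Lemma mass_nondecreasing : nondecreasing_seq (fun n => partial_sum o n w o).
Proof. by apply: partial_sum_nondecreasing => x; rewrite ltW ?weight_gt0. Qed.

Lemma is_cvg_mass : cvgn (fun n => partial_sum o n w o).
Proof.
apply: nondecreasing_is_cvgn; first exact: mass_nondecreasing.
by have [B Bw] := total_mass_bounded; exists B => _ [n _ <-].
Qed.

Lemma mass_le n : partial_sum o n w o <= M.
Proof. exact: nondecreasing_cvgn_le mass_nondecreasing is_cvg_mass n. Qed.

Lemma total_mass_gt0 : 0 < M.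
Proof.
apply: lt_le_trans (mass_le 1).
by rewrite /partial_sum big_ord1 /= big_seq1 weight_gt0.
Qed.

(** The values, at distance [n] from [v], of the function which is radial and
    harmonic on the sector of a son of [v], vanishes at [v] and is [1] at that
    son: the increments form a geometric progression of ratio [1 / q]. *)
Fixpoint radial n : R := if n is m.+1 then 1 + radial m / Q else 0.

Lemma radial_ge0 n : 0 <= radial n.
Proof.
by elim: n => //= n IHn; rewrite addr_ge0 ?divr_ge0 // ltW ?Q_gt0.
Qed.

Lemma radial_le2 n : radial n <= 2.
Proof.
elim: n => //= n IHn; rewrite -[X in _ <= X]/(1 + 1) lerD2l.
by rewrite ler_pdivrMr ?Q_gt0 // mul1r (le_trans IHn) ?Q_ge2.
Qed.

(** The squared norm of the radial harmonic function on the sector of a son of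
    [v], truncated to [n] levels and divided by the weight of [v]. *)
Definition radial_norm_sum n : R :=
  \sum_(k < n) Q ^+ k * radial k.+1 ^+ 2 * b ^- k.+1.

Lemma radial_term_ge0 k : 0 <= Q ^+ k * radial k.+1 ^+ 2 * b ^- k.+1.
Proof.
by rewrite !mulr_ge0 ?exprn_ge0 ?radial_ge0 ?invr_ge0 ?exprn_ge0 ?ltW
           ?Q_gt0 ?growth_gt0.
Qed.

Lemma radial_norm_sum_nondecreasing : nondecreasing_seq radial_norm_sum.
Proof.
apply/nondecreasing_seqP => n.
by rewrite /radial_norm_sum big_ord_recr lerDl radial_term_ge0.
Qed.

Lemma radial_norm_sum_le n : radial_norm_sum n <= 4 / b * c.
Proof.
have b0 := growth_gt0; have Q0 := Q_gt0.
have geo : \sum_(k < n) (Q / b) ^+ k <= c.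
  elim: n => [|n IHn]; first by rewrite big_ord0 ltW ?sector_ratio_gt0.
  rewrite big_ord_recl expr0 -[leRHS]sector_ratioE lerD2l.
  under eq_bigr do rewrite lift0 exprS.
  by rewrite -mulr_sumr ler_wpM2l // divr_ge0 ?ltW.
apply: (@le_trans _ _ (4 / b * \sum_(k < n) (Q / b) ^+ k)); last first.
  by rewrite ler_wpM2l // divr_ge0 ?ltW.
rewrite mulr_sumr; apply: ler_sum => k _.
have -> : 4 / b * (Q / b) ^+ k = Q ^+ k * 4 * b ^- k.+1.
  have bn0 : b != 0 by rewrite gt_eqF.
  by rewrite expr_div_n exprS; field; rewrite ?expf_neq0 ?bn0.
have Qk : 0 <= Q ^+ k by rewrite exprn_ge0 ?ltW.
have bk : 0 <= b ^- k.+1 by rewrite invr_ge0 exprn_ge0 ?ltW.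
rewrite (ler_wpM2r bk) // (ler_wpM2l Qk) //.
have -> : 4 = 2 ^+ 2 :> R by rewrite -natrX.
by rewrite lerXn2r ?nnegrE ?radial_ge0 ?radial_le2.
Qed.

Definition radial_norm : R := limn radial_norm_sum.
Local Notation B := radial_norm.

Lemma is_cvg_radial_norm : cvgn radial_norm_sum.
Proof.
apply: nondecreasing_is_cvgn; first exact: radial_norm_sum_nondecreasing.
by exists (4 / b * c) => _ [n _ <-]; exact: radial_norm_sum_le.
Qed.

Lemma radial_norm_gt0 : 0 < B.
Proof.
apply: lt_le_trans (nondecreasing_cvgn_le radial_norm_sum_nondecreasing
                      is_cvg_radial_norm 1).
rewrite /radial_norm_sum big_ord1 /= mul0r addr0 expr0 expr1n !mul1r.
by rewrite invr_gt0 exprn_gt0 ?growth_gt0.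
Qed.

(** With the origin as its own parent, the harmonicity equation is the
    conservation of the flux of the gradient, at the origin as elsewhere. *)
Definition conserves_flux u := forall x,
  \sum_(s <- sons o x) (u s - u x) = u x - u (parent o x).

Lemma size_sons_gt0 v : (size (sons o v))%:R != 0 :> R.
Proof.
rewrite pnatr_eq0; have [->|vo] := eqVneq v o; first by rewrite size_sons_origin.
by rewrite size_sons //; case: q hq.
Qed.

(** The flux of the gradient through each sphere of the sector of [y] is the
    same, so the mean of [u] on the spheres moves away from its value at the
    parent of [y] proportionally to [radial]. *)
Lemma sum_level_harmonic u n y : conserves_flux u -> y != o ->
  \sum_(x <- level o n y) u x
  = Q ^+ n * (u (parent o y) + radial n.+1 * (u y - u (parent o y))).
Proof.
move=> fu; have Q0 : Q != 0 by rewrite gt_eqF ?Q_gt0.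
elim: n y => [|n IHn] y yo; first by rewrite /= big_seq1; field.
rewrite sum_levelS.
transitivity (\sum_(s <- sons o y)
    (Q ^+ n * u y + Q ^+ n * radial n.+1 * (u s - u y))).
  apply: eq_big_seq => s; rewrite mem_sons => /andP[so /eqP sy].
  by rewrite IHn // sy mulrDr mulrA.
rewrite big_split /= -!mulr_sumr fu big_const_seq count_predT iter_addr_0.
rewrite size_sons // -[_ *+ q]mulr_natl exprS /=.
by move: (radial n) => r; field.
Qed.

Lemma sum_level_origin u n : conserves_flux u ->
  \sum_(x <- level o n o) u x = u o * \sum_(x <- level o n o) 1.
Proof.
move=> fu; case: n => [|n]; first by rewrite /= !big_seq1 mulr1.
have cst : conserves_flux (fun=> 1) by move=> x; rewrite subrr big1 // => s _; rewrite subrr.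
rewrite !sum_levelS mulr_sumr.
transitivity (\sum_(s <- sons o o) (Q ^+ n * u o + Q ^+ n * radial n.+1 * (u s - u o))).
  apply: eq_big_seq => s; rewrite mem_sons => /andP[so /eqP sy].
  by rewrite sum_level_harmonic // sy mulrDr mulrA.
rewrite big_split /= -!mulr_sumr fu parent_origin subrr mulr0 addr0 !mulr_sumr.
apply: eq_big_seq => s; rewrite mem_sons => /andP[so /eqP sy].
by rewrite (sum_level_harmonic _ cst) // subrr mulr0 addr0 mulr1 mulrC.
Qed.

End Kernel.

(** * An explicit kernel with the reproducing property *)
Section Reproducing.
Variables (R : realType) (q : nat) (X : homogeneous_tree q) (o : X) (alpha : R).
Hypotheses (hq : (2 <= q)%N) (halpha : 1 < alpha).
Implicit Types (v x y z : X) (u : X -> R).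

Local Notation d := (dist o).
Local Notation w := (weight o alpha).
Local Notation Q := (q%:R : R).
Local Notation b := (growth q alpha).
Local Notation M := (total_mass o alpha).
Local Notation B := (radial_norm q alpha).
Local Notation rad := (radial R q).
Local Notation par := (parent o).
Local Notation nsons v := ((size (sons o v))%:R : R).

(** With [v] the parent of [y], this is the harmonic function of the sector of
    [v] whose coefficients on the sons of [v] are those of the indicator of [y]
    minus its mean. It represents, up to a factor, the functional [excess]. *)
Definition branch y x : R :=
  rad (d x - d (par y))
  * ((descends o y x)%:R - (descends o (par y) x)%:R / nsons (par y)).

(** Away from [v] the recursion defining [radial] is the harmonicity equation;
    at [v] it says that the coefficients on the sons add up to zero. *)
Lemma branch_conserves_flux y : y != o -> conserves_flux o (branch y).
Proof.
move=> yo x; set v := par y.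
have v0 : branch y v = 0 by rewrite /branch subnn mul0r.
have son_x s : s \in sons o x -> [/\ s != o, par s = x & d s = (d x).+1].
  rewrite mem_sons => /andP[so /eqP sx]; split=> //.
  by rewrite -sx dist_parentS.
have [desc_vx|ndesc_vx] := boolP (descends o v x); last first.
  (* Outside the sector, only [v] can be a neighbour inside it. *)
  have ndesc_yx : ~~ descends o y x by apply: contra ndesc_vx; exact: descends_parent.
  have bx0 : branch y x = 0.
    by rewrite /branch (negbTE ndesc_vx) (negbTE ndesc_yx) mul0r subrr mulr0.
  have bp0 : branch y (par x) = 0.
    have [->|xo] := eqVneq x o.
      rewrite parent_origin; have [ov|nov] := eqVneq v o; first by rewrite -ov.
      have ndv : ~~ descends o v o.
        by apply: contra nov => /descends_dist; rewrite dist_origin leqn0 dist_eq0.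
      have ndy : ~~ descends o y o by apply: contra ndv; exact: descends_parent.
      by rewrite /branch (negbTE ndv) (negbTE ndy) mul0r subrr mulr0.
    have : ~~ descends o v (par x).
      by apply: contra ndesc_vx => dvp; rewrite descends_son // dvp.
    have : ~~ descends o y (par x).
      by apply: contra ndesc_yx => dvp; rewrite descends_son // dvp.
    by move=> /negbTE ny /negbTE nv; rewrite /branch nv ny mul0r subrr mulr0.
  rewrite bx0 bp0 subrr big1_seq // => s /andP[_ /son_x[so sx ds]].
  rewrite subr0; have [->//|sv] := eqVneq s v.
  have nvs : ~~ descends o v s by rewrite descends_son // sx negb_or ndesc_vx.
  have nys : ~~ descends o y s by apply: contra nvs; exact: descends_parent.
  by rewrite /branch (negbTE nvs) (negbTE nys) mul0r subrr mulr0.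
have dvx := descends_dist desc_vx.
have [xv|xv] := eqVneq x v.
  have -> : branch y (par x) = 0.
    have [xo|xo] := eqVneq x o; first by rewrite xo parent_origin -xo xv v0.
    rewrite /branch -/v (_ : d (par x) - d v = 0)%N ?mul0r //.
    by apply/eqP; rewrite subn_eq0 xv dist_parent leq_pred.
  have bx0 : branch y x = 0 by rewrite xv.
  rewrite bx0 subr0.
  transitivity (\sum_(s <- sons o x) ((s == y)%:R - (nsons v)^-1) : R).
    apply: eq_big_seq => s /son_x[so sx ds].
    rewrite subr0 /branch -/v ds xv subSnn /= mul0r addr0 mul1r.
    have -> : descends o v s by rewrite descends_son // sx desc_vx.
    rewrite mul1r; congr (_%:R - _); rewrite descends_son // sx orb_idl //.
    move=> /descends_dist; rewrite xv -(dist_parentS yo) ltnn //.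
  have ys : y \in sons o x by rewrite mem_sons yo xv eqxx.
  rewrite sumrB (bigD1_seq y) ?uniq_sons //= eqxx big1 => [|s /negbTE-> //].
  rewrite addr0 big_const_seq count_predT iter_addr_0 xv.
  by rewrite -[_ *+ size _]mulr_natl divff ?size_sons_gt0 // subrr.
have xo : x != o.
  apply: contra xv => /eqP xo; rewrite xo eq_sym -(dist_eq0 o) -leqn0.
  by rewrite -(dist_origin o) -[X in (_ <= d X)%N]xo.
have desc_vp : descends o v (par x).
  by move: desc_vx; rewrite descends_son // (negbTE xv) orbF.
have [n dx] : exists n, (d x - d v = n.+1)%N.
  exists (d x - d v).-1; rewrite prednK // subn_gt0 -(dist_parentS xo) ltnS.
  exact: descends_dist.
pose e : R := (descends o y x)%:R - (nsons v)^-1.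
have bx : branch y x = rad n.+1 * e by rewrite /branch -/v dx desc_vx mul1r.
have bp : branch y (par x) = rad n * e.
  rewrite /branch -/v (_ : d (par x) - d v = n)%N; last first.
    by apply/eqP; rewrite -eqSS -subSn ?descends_dist // dist_parentS // dx.
  have [xy|xy] := eqVneq x y; last first.
    by rewrite desc_vp mul1r /e (descends_son _ xo) (negbTE xy) orbF.
  move: dx; rewrite xy -(dist_parentS yo) subSnn => -[<-] /=.
  by rewrite !mul0r.
transitivity (\sum_(s <- sons o x) (rad n.+2 - rad n.+1) * e).
  apply: eq_big_seq => s /son_x[so sx ds].
  rewrite bx mulrBl; congr (_ - _).
  rewrite /branch -/v ds subSn // dx (descends_son v so) sx desc_vx mul1r.
  congr (_ * _).
  rewrite /e (descends_son y so) sx; case: (eqVneq s y) => [sy|]; last by rewrite orbF.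
  by move: xv; rewrite -sx sy eqxx.
rewrite bx bp -mulrBl big_const_seq count_predT iter_addr_0 size_sons //.
rewrite -[_ *+ q]mulr_natl mulrA; congr (_ * _) => /=.
have Q0 : Q != 0 by rewrite gt_eqF ?Q_gt0.
by field.
Qed.

(** For harmonic [u] this is [u y] minus the mean of [u] over the sons of the
    parent of [y], because the mean value property expresses that mean through
    the parent and the grandparent of [y]. *)
Definition excess u y : R := (u y - u (par y)) - (u (par y) - u (par (par y))) / Q.

Lemma branch_level u y k x : x \in level o k o ->
  u x * branch y x * w x
  = (descends o y x)%:R * (b ^- k * rad (k - d (par y)) * u x)
    - (descends o (par y) x)%:R
      * (b ^- k * rad (k - d (par y)) / nsons (par y) * u x).
Proof.
rewrite mem_level dist_origin add0n => /andP[/eqP dx _].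
by rewrite weightE dx /branch dx; ring.
Qed.

Lemma sum_level_branch_eq0 u y k : y != o -> (k <= d (par y))%N ->
  \sum_(x <- level o k o) u x * branch y x * w x = 0.
Proof.
move=> yo kv; rewrite (eq_big_seq _ (branch_level u y (k := k))) sumrB.
rewrite !sum_level_descends -(dist_parentS yo) ltnS kv sub0r.
case: ltngtP kv => // [_|->] _; first by rewrite oppr0.
by rewrite subnn big_seq1 !(mulr0, mul0r) oppr0.
Qed.

(** On each sphere about [par y] the constant part of the mean value formula
    drops out of the pairing, because the coefficients of [branch y] on the sons
    of [par y] add up to zero. *)
Lemma sum_level_branch u y n : conserves_flux o u -> y != o ->
  \sum_(x <- level o (d (par y) + n.+1) o) u x * branch y x * w x
  = b ^- d (par y) * (Q ^+ n * rad n.+1 ^+ 2 * b ^- n.+1) * excess u y.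
Proof.
move=> fu yo; set v := par y.
rewrite (eq_big_seq _ (branch_level u y (k := d v + n.+1))) sumrB.
rewrite !sum_level_descends -/v -(dist_parentS yo) -/v addKn.
rewrite [(_ < (d v).+1)%N]ltnNge [(_ < d v)%N]ltnNge leq_addr addnS ltnS leq_addr.
rewrite /= subSS addKn.
rewrite -!mulr_sumr sum_level_harmonic // -/v sum_levelS.
have -> : \sum_(s <- sons o v) \sum_(x <- level o n s) u x
   = Q ^+ n * (nsons v * u v + rad n.+1 * (u v - u (par v))).
  transitivity (\sum_(s <- sons o v)
    (Q ^+ n * u v + Q ^+ n * (rad n.+1 * (u s - u v)))).
    apply: eq_big_seq => s; rewrite mem_sons => /andP[so /eqP sv].
    by rewrite sum_level_harmonic // sv mulrDr.
  rewrite big_split /= -!mulr_sumr fu big_const_seq count_predT iter_addr_0.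
  by rewrite -[_ *+ size _]mulr_natl -[1 + _]/(rad n.+1); ring.
(* At the origin, with its [q + 1] sons, both sides vanish. *)
have meanE : (u v - u (par v)) / nsons v = (u v - u (par v)) / Q.
  have [->|vo] := eqVneq v o; first by rewrite parent_origin subrr !mul0r.
  by rewrite size_sons.
rewrite /excess -/v -meanE !exprS exprD.
have n0 := @size_sons_gt0 R q X o hq v; have b0 : b != 0 by rewrite gt_eqF ?growth_gt0.
have Q0 : Q != 0 by rewrite gt_eqF ?Q_gt0.
rewrite expr0 /=; move: (rad n) (expf_neq0 (d v) b0) (expf_neq0 n b0) => r.
move: (b ^+ d v) (b ^+ n) (Q ^+ n) => p p' p'' p0 p'0.
by field; rewrite p0 p'0 b0 n0 Q0.
Qed.

Lemma cvg_branch u y : conserves_flux o u -> y != o ->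
  partial_sum o n (fun x => u x * branch y x * w x) o @[n --> \oo]
    --> b ^- d (par y) * B * excess u y.
Proof.
move=> fu yo; rewrite -(cvg_shiftn (d (par y)).+1) /=.
have -> : (fun n => partial_sum o (n + (d (par y)).+1)
             (fun x => u x * branch y x * w x) o)
          = (fun n => b ^- d (par y) * radial_norm_sum q alpha n * excess u y).
  apply/funext; elim=> [|n IHn].
    rewrite /radial_norm_sum big_ord0 mulr0 mul0r /partial_sum big1 // => k _.
    by rewrite sum_level_branch_eq0 // -ltnS.
  have -> : radial_norm_sum q alpha n.+1
      = radial_norm_sum q alpha n + Q ^+ n * rad n.+1 ^+ 2 * b ^- n.+1.
    exact: big_ord_recr.
  rewrite addSn partial_sum_recr IHn.
  rewrite (_ : n + (d (par y)).+1 = d (par y) + n.+1)%N; last by rewrite addnC addSnnS.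
  by rewrite sum_level_branch //; move: (excess u y) => e; ring.
apply: cvgM; last exact: cvg_cst.
by apply: cvgM; [exact: cvg_cst|exact: is_cvg_radial_norm].
Qed.

Local Notation ancestor j z := (iter j (parent o) z).

Lemma ancestor_neq_origin j z : (j < d z)%N -> ancestor j z != o.
Proof. by rewrite -dist_eq0 dist_iter_parent subn_eq0 -ltnNge. Qed.

(** Written with the increments [delta] of [u] along the path from the origin to
    [z], the excess is [delta_k - delta_(k-1) / q]. *)
Lemma sum_excess u z :
  \sum_(j < d z) excess u (ancestor j z) = (u z - u o) - (u (par z) - u o) / Q.
Proof.
have [n] := ubnP (d z); elim: n z => // n IHn z; rewrite ltnS => dzn.
have [->|zo] := eqVneq z o.
  by rewrite dist_origin big_ord0 parent_origin !subrr mul0r subrr.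
rewrite -(dist_parentS zo) big_ord_recl.
under eq_bigr do rewrite lift0 iterSr.
rewrite IHn; last by rewrite (leq_trans _ dzn) // -(dist_parentS zo).
have Q0 : Q != 0 by rewrite gt_eqF ?Q_gt0.
by rewrite /excess /=; field.
Qed.

(** The recursion [radial j.+2 = 1 + radial j.+1 / q] splits the sum into the
    previous lemma and the same sum for the parent of [z]. *)
Lemma sum_radial_excess u z :
  \sum_(j < d z) rad j.+1 * excess u (ancestor j z) = u z - u o.
Proof.
have [n] := ubnP (d z); elim: n z => // n IHn z; rewrite ltnS => dzn.
have [->|zo] := eqVneq z o; first by rewrite dist_origin big_ord0 subrr.
rewrite -(dist_parentS zo) big_ord_recl.
transitivity (excess u z + \sum_(j < d (par z)) (excess u (ancestor j (par z))
    + Q^-1 * (rad j.+1 * excess u (ancestor j (par z))))).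
  congr (_ + _); first by rewrite /= mul0r addr0 mul1r.
  apply: eq_bigr => j _; rewrite lift0 iterSr -[rad j.+2]/(1 + rad j.+1 / Q).
  by move: (rad j.+1) (excess _ _) => r e; ring.
rewrite big_split /= -mulr_sumr IHn; last first.
  by rewrite (leq_trans _ dzn) // -(dist_parentS zo).
rewrite sum_excess /excess.
have Q0 : Q != 0 by rewrite gt_eqF ?Q_gt0.
by field.
Qed.

(** The first term is the kernel of the constants; the others are the kernels,
    at [z], of the harmonic functions attached to the strict ancestors of [z].
    The [j]-th vertex of the path from [z] to the origin is the son through
    which the sector of its parent, [ancestor j.+1 z], is entered. *)
Definition explicit_kernel z x : R :=
  M^-1 + \sum_(j < d z) b ^+ d (ancestor j.+1 z) / B * rad j.+1
                        * branch (ancestor j z) x.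

(** The sums over balls are computed exactly: the constants reproduce [u o], each
    branch reproduces one excess, and the excesses telescope to [u z - u o]. *)
Lemma cvg_explicit_kernel u z : conserves_flux o u ->
  partial_sum o n (fun x => u x * explicit_kernel z x * w x) o @[n --> \oo]
    --> u z.
Proof.
move=> fu; have M0 := @total_mass_gt0 R q X o alpha hq halpha.
have B0 := radial_norm_gt0 hq halpha; have b0 := growth_gt0 hq halpha.
pose coef j : R := b ^+ d (ancestor j.+1 z) / B * rad j.+1.
have uKE x : u x * explicit_kernel z x * w x = M^-1 * (u x * w x)
    + \sum_(j <- index_enum 'I_(d z)) coef j * (u x * branch (ancestor j z) x * w x).
  rewrite /explicit_kernel mulrDr mulrDl; congr (_ + _); first by ring.
  rewrite mulr_sumr mulr_suml; apply: eq_bigr => j _; rewrite /coef.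
  by move: (b ^+ _) (rad _) (branch _ _) => p r c; ring.
have -> : (fun n => partial_sum o n (fun x => u x * explicit_kernel z x * w x) o)
  = (fun n => M^-1 * (u o * partial_sum o n w o) + \sum_(j < d z)
      coef j * partial_sum o n (fun x => u x * branch (ancestor j z) x * w x) o).
  apply/funext => n; rewrite (eq_partial_sum _ _ _ uKE) partial_sumD partial_sumZ.
  rewrite partial_sum_sum; congr (_ * _ + _).
    rewrite /partial_sum mulr_sumr; apply: eq_bigr => k _.
    have wk x : x \in level o k o -> w x = b ^- k.
      by rewrite mem_level dist_origin => /andP[/eqP dx _]; rewrite weightE dx.
    transitivity (\sum_(x <- level o k o) u x * b ^- k).
      by apply: eq_big_seq => x /wk ->.
    rewrite (eq_big_seq _ wk) -mulr_suml sum_level_origin // -mulrA; congr (_ * _).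
    by rewrite mulr_suml; apply: eq_bigr => x _; rewrite mul1r.
  by apply: eq_bigr => j _; rewrite partial_sumZ.
have -> : u z = M^-1 * (u o * M) + \sum_(j < d z)
    coef j * (b ^- d (par (ancestor j z)) * B * excess u (ancestor j z)).
  rewrite mulrCA mulVf ?mulr1 ?gt_eqF //.
  rewrite -[LHS](subrK (u o)) addrC -sum_radial_excess; congr (_ + _).
  have cancel (p r e : R) : p != 0 -> r * e = p / B * r * (p^-1 * B * e).
    by move=> p0; field; rewrite p0 gt_eqF.
  by apply: eq_bigr => j _; apply: cancel; rewrite expf_neq0 ?gt_eqF.
apply: cvgD.
  by do 2![apply: cvgM; first exact: cvg_cst]; exact: is_cvg_mass.
apply: cvg_big => [|j _]; first exact: add_continuous.
apply: cvgM; first exact: cvg_cst.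
by apply: cvg_branch => //; exact: ancestor_neq_origin.
Qed.

End Reproducing.

(** * Identification of the Bergman kernel *)
Section BergmanKernel.
Variables (R : realType) (q : nat) (X : homogeneous_tree q) (o : X) (alpha : R).
Hypotheses (hq : (2 <= q)%N) (halpha : 1 < alpha).
Implicit Types (v x y z : X) (u h : X -> R) (f g : X -> R[i]).

Local Open Scope complex_scope.

Local Notation d := (dist o).
Local Notation w := (weight o alpha).
Local Notation Q := (q%:R : R).
Local Notation b := (growth q alpha).
Local Notation M := (total_mass o alpha).
Local Notation B := (radial_norm q alpha).
Local Notation rad := (radial R q).
Local Notation par := (parent o).
Local Notation ancestor j z := (iter j (parent o) z).
Local Notation K := (explicit_kernel o alpha).

Lemma Re_sum I (r : seq I) (F : I -> R[i]) :
  complex.Re (\sum_(i <- r) F i) = \sum_(i <- r) complex.Re (F i).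
Proof.
elim: r => [|i r IHr]; first by rewrite !big_nil.
by rewrite !big_cons -IHr; case: (F i) (\sum_(j <- r) F j) => [a a'] [c c'].
Qed.

Lemma Im_sum I (r : seq I) (F : I -> R[i]) :
  complex.Im (\sum_(i <- r) F i) = \sum_(i <- r) complex.Im (F i).
Proof.
elim: r => [|i r IHr]; first by rewrite !big_nil.
by rewrite !big_cons -IHr; case: (F i) (\sum_(j <- r) F j) => [a a'] [c c'].
Qed.

Lemma real_complex_sum I (r : seq I) (F : I -> R) :
  (\sum_(i <- r) F i)%:C = \sum_(i <- r) (F i)%:C.
Proof. exact: rmorph_sum. Qed.

Lemma cmod_real (r : R) : cmod r%:C = `|r|.
Proof. by rewrite /cmod normc_def /= expr0n addr0 sqrtr_sqr. Qed.

Lemma sqr_cmod (c : R[i]) : cmod c ^+ 2 = complex.Re c ^+ 2 + complex.Im c ^+ 2.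
Proof. by rewrite /cmod normc_def /= sqr_sqrtr // addr_ge0 ?sqr_ge0. Qed.

Lemma cmod_ge0 (c : R[i]) : 0 <= cmod c.
Proof. by rewrite /cmod normc_def sqrtr_ge0. Qed.

Lemma Re_le_cmod (c : R[i]) : `|complex.Re c| <= cmod c.
Proof.
rewrite -(@ler_pXn2r _ 2) ?nnegrE ?cmod_ge0 // sqr_cmod real_normK ?num_real //.
by rewrite lerDl sqr_ge0.
Qed.

Lemma Im_le_cmod (c : R[i]) : `|complex.Im c| <= cmod c.
Proof.
rewrite -(@ler_pXn2r _ 2) ?nnegrE ?cmod_ge0 // sqr_cmod real_normK ?num_real //.
by rewrite lerDr sqr_ge0.
Qed.

Lemma cmod_le (c : R[i]) : cmod c <= `|complex.Re c| + `|complex.Im c|.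
Proof.
rewrite -(@ler_pXn2r _ 2) ?nnegrE ?cmod_ge0 ?addr_ge0 // sqr_cmod sqrrD.
rewrite !real_normK ?num_real // addrAC lerDl.
by rewrite mulrn_wge0 // mulr_ge0.
Qed.

Lemma harmonicP f : harmonic f <->
  forall x, \sum_(s <- sons o x) (f s - f x) = f x - f (par x).
Proof.
suff fluxE x : (f x == (q.+1%:R)^-1 * \sum_(y \in [set y | adj x y]) f y)
    = (\sum_(s <- sons o x) (f s - f x) == f x - f (par x)).
  by split=> fP x; apply/eqP; [rewrite -fluxE|rewrite fluxE]; apply/eqP; exact: fP.
have q0 : q.+1%:R != 0 :> R[i] by rewrite pnatr_eq0.
rewrite (fsbig_finite _ _ (finite_neighbours x)) /= -/(neighbours x).
rewrite -(inj_eq (mulfI q0)) mulrA divff // mul1r.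
rewrite sumrB big_const_seq count_predT iter_addr_0 -[_ *+ size _]mulr_natl.
have [->|xo] := eqVneq x o.
  rewrite (perm_big _ (neighbours_origin o)) size_sons_origin parent_origin.
  by rewrite subrr subr_eq0 eq_sym.
rewrite (perm_big _ (neighbours_parent xo)) big_cons size_sons //= eq_sym.
rewrite -subr_eq0 -[RHS]subr_eq0; congr (_ == 0).
by rewrite -natr1; ring.
Qed.

Lemma harmonic_Re f : harmonic f -> conserves_flux o (fun x => complex.Re (f x)).
Proof.
move=> /harmonicP fP x; have := congr1 (@complex.Re R) (fP x).
rewrite Re_sum; case: (f x) (f (par x)) => [a c] [a' c'] /= <-.
by apply: eq_bigr => s _; case: (f s).
Qed.

Lemma harmonic_Im f : harmonic f -> conserves_flux o (fun x => complex.Im (f x)).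
Proof.
move=> /harmonicP fP x; have := congr1 (@complex.Im R) (fP x).
rewrite Im_sum; case: (f x) (f (par x)) => [a c] [a' c'] /= <-.
by apply: eq_bigr => s _; case: (f s).
Qed.

Lemma harmonic_real u : conserves_flux o u -> harmonic (fun x => (u x)%:C).
Proof.
move=> fu; apply/harmonicP => x.
transitivity (u x - u (par x))%:C; last exact: rmorphB.
by rewrite -fu real_complex_sum; apply: eq_bigr => s _; rewrite rmorphB.
Qed.

Lemma explicit_kernel_conserves_flux z : conserves_flux o (K z).
Proof.
move=> x; have KB s t : K z s - K z t = \sum_(j < d z) b ^+ d (ancestor j.+1 z)
    / B * rad j.+1 * (branch R o (ancestor j z) s - branch R o (ancestor j z) t).
  rewrite /explicit_kernel opprD addrACA subrr add0r -sumrB.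
  by apply: eq_bigr => j _; rewrite mulrBr.
rewrite KB (eq_bigr _ (fun s _ => KB s x)) exchange_big /=.
apply: eq_bigr => j _; rewrite -mulr_sumr; congr (_ * _).
by rewrite branch_conserves_flux // ancestor_neq_origin.
Qed.

(** The coefficients of [branch y] on the sons are at most [1] in modulus. *)
Lemma branch_norm_le y x : y != o ->
  `|branch R o y x| <= 2 * (descends o (par y) x)%:R.
Proof.
move=> yo; rewrite /branch normrM.
have [desc_vx|ndesc_vx] := boolP (descends o (par y) x); last first.
  have /negbTE-> : ~~ descends o y x.
    by apply: contra ndesc_vx; exact: descends_parent.
  by rewrite mul0r subrr normr0 !mulr0.
rewrite mul1r mulr1 -[leRHS]mulr1 ler_pM //.
  by rewrite ger0_norm ?radial_ge0 ?radial_le2.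
have m1 : 1 <= (size (sons o (par y)))%:R :> R.
  by rewrite ler1n lt0n -(pnatr_eq0 R) size_sons_gt0.
have m0 := lt_le_trans ltr01 m1.
have i0 : 0 < ((size (sons o (par y)))%:R : R)^-1 by rewrite invr_gt0.
have i1 : ((size (sons o (par y)))%:R : R)^-1 <= 1 by rewrite invf_le1.
by rewrite ler_norml; case: (descends o y x) => /=; lra.
Qed.

Definition kernel_const : R := M^-1 + 4 / B.

Lemma kernel_const_gt0 : 0 < kernel_const.
Proof.
by rewrite addr_gt0 ?invr_gt0 ?divr_gt0 ?total_mass_gt0 ?radial_norm_gt0.
Qed.

(** The last term of the sum, at the origin, takes care of the constants; the
    term of [branch (ancestor j z)] is absorbed by the one of index [j.+1]. *)
Lemma explicit_kernel_le z x : `|K z x| <= kernel_const *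
  \sum_(j < (d z).+1) b ^+ d (ancestor j z) * (descends o (ancestor j z) x)%:R.
Proof.
have M0 := @total_mass_gt0 R q X o alpha hq halpha.
have B0 := radial_norm_gt0 hq halpha; have b0 := growth_gt0 hq halpha.
have bk k : 0 <= b ^+ k by rewrite exprn_ge0 ?ltW.
pose t j : R := b ^+ d (ancestor j z) * (descends o (ancestor j z) x)%:R.
have t0 j : 0 <= t j by rewrite mulr_ge0 ?ler0n.
rewrite -/(\sum_(j < (d z).+1) t j) mulrDl.
apply: le_trans (ler_normD _ _) _; apply: lerD.
  have Mi : 0 <= M^-1 by rewrite invr_ge0 ltW.
  rewrite ger0_norm // ler_peMr //.
  rewrite big_ord_recr /= {2}/t iter_parent_dist dist_origin descends_origin.
  by rewrite expr0 mulr1 lerDr sumr_ge0.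
apply: le_trans (ler_norm_sum _ _ _) _.
(* The term of index 0 is dropped to align the two sums. *)
rewrite big_ord_recl mulrDr mulr_sumr -[leLHS]add0r; apply: lerD.
  by apply: mulr_ge0; [rewrite divr_ge0 // ltW|exact: t0].
have bB k : 0 <= b ^+ k / B by rewrite divr_ge0 // ltW.
apply: ler_sum => j _; rewrite lift0 normrM ger0_norm; last first.
  by rewrite mulr_ge0 ?radial_ge0.
have yo : ancestor j z != o by exact: ancestor_neq_origin.
have := branch_norm_le x yo; rewrite -[par _]/(ancestor j.+1 z) => le_br.
apply: (@le_trans _ _ (b ^+ d (ancestor j.+1 z) / B * 2
   * (2 * (descends o (ancestor j.+1 z) x)%:R))).
  apply: ler_pM => //; first by rewrite mulr_ge0 ?radial_ge0.
  by rewrite ler_wpM2l ?radial_le2.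
rewrite /t; move: (b ^+ _) ((descends _ _ _)%:R) => p r.
by rewrite le_eqVlt; apply/orP; left; apply/eqP; ring.
Qed.

Lemma explicit_kernel_bounded z : exists N, forall x, `|K z x| <= N.
Proof.
exists (kernel_const * \sum_(j < (d z).+1) b ^+ d (ancestor j z)) => x.
apply: le_trans (explicit_kernel_le z x) _.
rewrite ler_wpM2l ?(ltW kernel_const_gt0) //; apply: ler_sum => j _.
rewrite ler_piMr ?lern1 ?leq_b1 // exprn_ge0 // ltW //; exact: growth_gt0.
Qed.

Lemma in_A2_explicit_kernel z : in_A2 o alpha (fun x => (K z x)%:C).
Proof.
split; first exact/harmonic_real/explicit_kernel_conserves_flux.
have [N KN] := explicit_kernel_bounded z.
rewrite /in_Lp /Lp_powernorm.
apply: (@le_lt_trans _ _ (N ^+ 2 * M)%:E); last exact: ltry.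
have w0 x : 0 <= w x by rewrite ltW ?weight_gt0.
apply: esum_le_partial_sum => [x|n]; first by rewrite mulr_ge0 ?powR_ge0.
apply: (@le_trans _ _ (partial_sum o n (fun x => N ^+ 2 * w x) o)).
  apply: le_partial_sum => x; rewrite ler_wpM2r // powR_mulrn ?cmod_ge0 //.
  have N0 : 0 <= N by exact: le_trans (KN x).
  by rewrite cmod_real ler_pXn2r ?nnegrE.
by rewrite partial_sumZ ler_wpM2l ?sqr_ge0 // mass_le.
Qed.

(** Since the kernel is bounded and the total mass is finite, the bound
    [|u| <= 1 + u^2] makes the reproducing integral absolutely convergent. *)
Lemma bounded_sums_kernel g u z : in_Lp o alpha 2 g ->
  (forall x, `|u x| <= cmod (g x)) -> bounded_sums o (fun x => u x * K z x * w x).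
Proof.
move=> g2 ug; have [N KN] := explicit_kernel_bounded z.
have N0 : 0 <= N by exact: le_trans (KN z).
have w0 x : 0 <= w x by rewrite ltW ?weight_gt0.
pose h x := cmod (g x) `^ 2 * w x.
have h0 x : 0 <= h x by rewrite mulr_ge0 ?powR_ge0.
have [S hS] : exists S, forall n, partial_sum o n h o <= S.
  exists (fine (Lp_powernorm o alpha 2 g)) => n.
  rewrite -lee_fin fineK; first exact: partial_sum_le_esum.
  rewrite ge0_fin_numE; first exact: g2.
  by apply: esum_ge0 => x _; rewrite lee_fin; exact: h0.
exists (N * (M + S)) => n.
apply: (@le_trans _ _ (partial_sum o n (fun x => N * (w x + h x)) o)).
  apply: le_partial_sum => x; rewrite !normrM (ger0_norm (w0 x)) mulrAC mulrC.
  apply: ler_pM => //; first exact: mulr_ge0.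
  rewrite /h powR_mulrn ?cmod_ge0 // -[X in X + _]mul1r -mulrDl ler_wpM2r //.
  apply: le_trans (ug x) _; move: (cmod (g x)) (cmod_ge0 (g x)) => r r0.
  by have := sqr_ge0 (r - 1); rewrite sqrrB1; lra.
by rewrite partial_sumZ partial_sumD ler_wpM2l // lerD ?mass_le.
Qed.

Lemma csum_kernel g z : in_A2 o alpha g ->
  csum (fun x => g x * (K z x)%:C * (w x)%:C) = g z.
Proof.
move=> [harm_g g2]; have mulE (c : R[i]) (r s : R) :
    c * r%:C * s%:C = (complex.Re c * r * s) +i* (complex.Im c * r * s).
  by case: c => a c; simpc.
rewrite /csum [RHS](_ : _ = complex.Re (g z) +i* complex.Im (g z)); last by case: (g z).
congr (_ +i* _).
  rewrite (_ : (fun x => _) = fun x => complex.Re (g x) * K z x * w x); last first.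
    by apply/funext => x; rewrite mulE.
  apply: rsum_eq; first by apply: bounded_sums_kernel g2 _ => x; exact: Re_le_cmod.
  by apply: cvg_explicit_kernel => //; exact: harmonic_Re.
rewrite (_ : (fun x => _) = fun x => complex.Im (g x) * K z x * w x); last first.
  by apply/funext => x; rewrite mulE.
apply: rsum_eq; first by apply: bounded_sums_kernel g2 _ => x; exact: Im_le_cmod.
by apply: cvg_explicit_kernel => //; exact: harmonic_Im.
Qed.

Lemma reproducing_kernel_explicit : reproducing_kernel o alpha K.
Proof. by split=> [z|g z]; [exact: in_A2_explicit_kernel|exact: csum_kernel]. Qed.

(** Both sides are the pairing of [K1 z] with [K2 x], evaluated by means of
    either kernel. With [K1 = K2] this is symmetry; the two together give
    uniqueness. *)
Lemma reproducing_kernel_sym K1 K2 z x :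
  reproducing_kernel o alpha K1 -> reproducing_kernel o alpha K2 ->
  K1 z x = K2 x z.
Proof.
move=> [K1A K1r] [K2A K2r]; apply: (@complexI R).
rewrite -(K2r _ x (K1A z)) -(K1r _ z (K2A x)); congr csum.
by apply/funext => t; rewrite [_%:C * (K2 x t)%:C]mulrC.
Qed.

Lemma bergman_kernelE : bergman_kernel o alpha = K.
Proof.
have Krep := reproducing_kernel_explicit.
apply: xget_unique => // K' K'rep; apply/funext => z; apply/funext => x.
by rewrite (reproducing_kernel_sym z x K'rep Krep) (reproducing_kernel_sym x z Krep Krep).
Qed.

End BergmanKernel.

(** * Weak type of the sum of the averages over sectors *)
Section WeakType.
Variables (R : realType) (q : nat) (X : homogeneous_tree q) (o : X) (alpha : R).
Hypotheses (hq : (2 <= q)%N) (halpha : 1 < alpha).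
Variable h : X -> R.
Hypotheses (h_ge0 : forall x, 0 <= h x) (h_bounded : bounded_sums o h).
Implicit Types (v x y z : X).

Local Notation d := (dist o).
Local Notation w := (weight o alpha).
Local Notation Q := (q%:R : R).
Local Notation b := (growth q alpha).
Local Notation M := (total_mass o alpha).
Local Notation c := (sector_ratio q alpha).
Local Notation par := (parent o).
Local Notation ancestor j z := (iter j (parent o) z).

Definition sector v : R := limn (fun n => partial_sum o n h v).

Lemma is_cvg_sector v : cvgn (fun n => partial_sum o n h v).
Proof.
apply: nondecreasing_is_cvgn; first exact: partial_sum_nondecreasing.
have [N hN] := h_bounded; exists N => _ [n _ <-].
apply: le_trans (hN (n + d v)%N).
rewrite -[X in partial_sum _ X](addnK (d v)) -partial_sum_descends.
apply: le_partial_sum => x; rewrite ger0_norm //.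
by case: (descends _ _ _); rewrite ?mul1r ?mul0r.
Qed.

Lemma le_sector n v : partial_sum o n h v <= sector v.
Proof.
apply: (nondecreasing_cvgn_le _ (@is_cvg_sector v)).
exact: partial_sum_nondecreasing.
Qed.

Lemma sector_ge0 v : 0 <= sector v.
Proof. exact: le_trans (partial_sum_ge0 o 0 v h_ge0) (le_sector 0 v). Qed.

Lemma sum_sector_sons v : \sum_(s <- sons o v) sector s <= sector v.
Proof.
have cv : \sum_(s <- sons o v) partial_sum o n h s @[n --> \oo]
    --> \sum_(s <- sons o v) sector s.
  by apply: cvg_big => [|s _]; [exact: add_continuous|exact: is_cvg_sector].
apply: (cvgr_to_le cv); near=> n; apply: le_trans (le_sector n.+1 v).
by rewrite partial_sum_recl lerDr.
Unshelve. all: by end_near.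
Qed.

(** The weight of [v] stands for the mass of its sector, to which it is
    comparable by [sector_mass_le]. *)
Definition average v : R := sector v / w v.

Definition sum_averages z : R := \sum_(j < (d z).+1) average (ancestor j z).
Local Notation S := sum_averages.

Lemma average_ge0 v : 0 <= average v.
Proof. by rewrite divr_ge0 ?sector_ge0 // ltW ?weight_gt0. Qed.

Lemma sum_averages_origin : S o = average o.
Proof. by rewrite /sum_averages dist_origin big_ord1. Qed.

Lemma sum_averages_parent v : v != o -> S v = S (par v) + average v.
Proof.
move=> vo; rewrite /sum_averages -(dist_parentS vo) big_ord_recl addrC.
by congr (_ + _); apply: eq_bigr => j _; rewrite lift0 iterSr.
Qed.

Definition level_set_mass n (la : R) v : R :=
  partial_sum o n (fun x => (la < S x)%R%:R * w x) v.

Lemma level_set_mass_le_mass n la v :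
  level_set_mass n la v <= partial_sum o n w v.
Proof.
apply: le_partial_sum => x; have w0 := weight_gt0 o hq halpha x.
by case: (la < S x)%R; [rewrite mul1r|rewrite mul0r ltW].
Qed.

(* The coefficient [a] for which the induction closes: it equals
   [q / (b - q)], the solution of [a * (b / q - 1) = 1]. *)
Local Notation aa := (c - 1).

(** A concave function lies below its tangents: this replaces the inequality of
    Jensen, with the upper bound of the mean as point of tangency. *)
Lemma tangent_bound (l k T t : R) : 0 < l -> 0 <= k -> 0 <= T -> 0 <= t ->
  t / (l + k * t) <= T / (l + k * T) + l / (l + k * T) ^+ 2 * (t - T).
Proof.
move=> l0 k0 T0 t0.
have lt0 : 0 < l + k * t by rewrite ltr_pwDl ?mulr_ge0.
have lT0 : 0 < l + k * T by rewrite ltr_pwDl ?mulr_ge0.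
rewrite -subr_ge0.
have -> : T / (l + k * T) + l / (l + k * T) ^+ 2 * (t - T) - t / (l + k * t)
    = l * k * (t - T) ^+ 2 / ((l + k * T) ^+ 2 * (l + k * t)).
  by field; rewrite !gt_eqF.
have lk0 : 0 <= l * k by rewrite mulr_ge0 // ltW.
apply: divr_ge0; first by rewrite mulr_ge0 ?sqr_ge0.
by apply: mulr_ge0; [exact: sqr_ge0|exact: ltW].
Qed.

(** The bound is an increasing concave function of the average at [v], it is
    reproduced by one step of the recursion, and it is at least the mass of
    the whole sector once the average at [v] alone reaches the level left. *)
Lemma level_set_mass_le n la v : v != o -> S (par v) < la ->
  level_set_mass n la v
  <= c ^+ 2 * sector v / (la - S (par v) + aa * average v).
Proof.
have b0 := growth_gt0 hq halpha; have Q0 := Q_gt0 R hq.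
have bQ : 0 < b - Q by rewrite subr_gt0 growth_gtQ.
have c0 := sector_ratio_gt0 hq halpha.
have aaE : aa = Q / (b - Q) by rewrite /sector_ratio; field; rewrite gt_eqF.
have aa0 : 0 < aa by rewrite aaE divr_gt0.
elim: n v => [|n IHn] v vo la_v.
  rewrite /level_set_mass /partial_sum big_ord0; apply: divr_ge0.
    by rewrite mulr_ge0 ?sqr_ge0 ?sector_ge0.
  apply: addr_ge0; first by rewrite subr_ge0 ltW.
  by apply: mulr_ge0; [exact: ltW|exact: average_ge0].
have wv0 := weight_gt0 o hq halpha v.
have t0 := average_ge0 v.
have secE : sector v = average v * w v by rewrite divfK ?gt_eqF.
set l := la - S (par v); have l0 : 0 < l by rewrite subr_gt0.
set t := average v in t0 secE *.
have [lt|tl] := leP l t.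
  (* The average at [v] may already exceed the level: count everything. *)
  apply: le_trans (level_set_mass_le_mass _ _ _) _.
  apply: le_trans (sector_mass_le hq halpha _ vo) _.
  have den : 0 < l + aa * t by rewrite ltr_pwDl // mulr_ge0 // ltW.
  rewrite ler_pdivlMr // secE (_ : _ * (t * w v) = c * w v * (c * t)); last by ring.
  by rewrite (ler_pM2l (mulr_gt0 c0 wv0)); lra.
have Sv : S v = la - (l - t) by rewrite sum_averages_parent // /l -/t; ring.
have lt0 : 0 < l - t by rewrite subr_gt0.
rewrite /level_set_mass partial_sum_recl -/(level_set_mass n la).
have -> : (la < S v)%R = false by apply/negbTE; rewrite -leNgt Sv; lra.
rewrite mul0r add0r.
(* The largest mean value that the averages at the [q] sons can have. *)
pose T := b / Q * t; pose den := l - t + aa * T.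
have T0 : 0 <= T by rewrite mulr_ge0 // divr_ge0 ?ltW.
have den0 : 0 < den by rewrite ltr_pwDl // mulr_ge0 // ltW.
have sonE s : s \in sons o v -> sector s = average s * (w v / b).
  by move=> sv; rewrite -(weight_son alpha sv) divfK // gt_eqF ?weight_gt0.
have wb0 : 0 < w v / b by rewrite divr_gt0.
have cwb0 : 0 <= c ^+ 2 * (w v / b) by rewrite mulr_ge0 ?sqr_ge0 // ltW.
have step s : s \in sons o v -> level_set_mass n la s
    <= c ^+ 2 * (w v / b) * (T / den + (l - t) / den ^+ 2 * (average s - T)).
  move=> sv; have := sv; rewrite mem_sons => /andP[so /eqP spar].
  have Sla : S (par s) < la by rewrite spar Sv; lra.
  apply: le_trans (IHn s so Sla) _.
  rewrite spar Sv opprB addrCA subrr addr0 sonE //.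
  rewrite (_ : _ / _ = c ^+ 2 * (w v / b) * (average s / (l - t + aa * average s))); last by ring.
  rewrite (ler_wpM2l cwb0) //.
  exact: tangent_bound lt0 (ltW aa0) T0 (average_ge0 s).
apply: le_trans (_ : \sum_(s <- sons o v) c ^+ 2 * (w v / b)
   * (T / den + (l - t) / den ^+ 2 * (average s - T)) <= _).
  by rewrite big_seq [leRHS]big_seq; apply: ler_sum => s; exact: step.
rewrite -mulr_sumr big_split /= -!mulr_sumr sumrB.
rewrite !big_const_seq !count_predT !iter_addr_0 size_sons //.
have sum_av : \sum_(s <- sons o v) average s <= T *+ q.
  rewrite -(ler_pM2r wb0) mulr_suml.
  rewrite (_ : \sum_(s <- _) _ = \sum_(s <- sons o v) sector s).
    apply: le_trans (sum_sector_sons v) _; rewrite secE -mulr_natl /T.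
    by rewrite le_eqVlt; apply/orP; left; apply/eqP; field; rewrite !gt_eqF.
  by apply: eq_big_seq => s sv; rewrite sonE.
apply: (@le_trans _ _ (c ^+ 2 * (w v / b) * (T * (den^-1 *+ q)))).
  rewrite (ler_wpM2l cwb0) // gerDl mulr_ge0_le0 ?subr_le0 //.
  by rewrite divr_ge0 ?sqr_ge0 // ltW.
(* The choice of [aa] enters here. *)
have -> : l + aa * t = den by rewrite /den /T aaE; field; rewrite !gt_eqF.
rewrite -mulr_natl secE /T le_eqVlt; apply/orP; left; apply/eqP.
by move: den0 => /gt_eqF den0; field; rewrite den0 !gt_eqF.
Qed.

(** The recursion does not close at the origin, which has one more son, but a
    crude step suffices there: unless the average at the origin is at least half
    the level, at least half the level is left for the sons. *)
Lemma level_set_mass_origin n la : 0 < la ->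
  level_set_mass n la o <= 2 * (M + c ^+ 2) * sector o / la.
Proof.
move=> la0; have b0 := growth_gt0 hq halpha; have Q0 := Q_gt0 R hq.
have M0 := @total_mass_gt0 R q X o alpha hq halpha.
have s0 := sector_ge0 o.
have wo : w o = 1 by rewrite weightE dist_origin expr0 invr1.
have avo : average o = sector o by rewrite /average wo divr1.
have aa0 : 0 <= aa.
  rewrite -(sector_ratioE hq halpha) addrAC subrr add0r.
  apply: mulr_ge0; last exact/ltW/(sector_ratio_gt0 hq halpha).
  by apply: divr_ge0; exact: ltW.
rewrite ler_pdivlMr //.
have [large|small] := leP la (2 * sector o).
  apply: (@le_trans _ _ (M * la)).
    rewrite ler_pM2r //; apply: le_trans (level_set_mass_le_mass _ _ _) _.
    exact: mass_le.
  apply: (@le_trans _ _ (M * (2 * sector o))); first by rewrite ler_pM2l.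
  by rewrite mulrA [M * 2]mulrC ler_wpM2r // ler_pM2l // lerDl sqr_ge0.
case: n => [|n].
  rewrite /level_set_mass /partial_sum big_ord0 mul0r mulr_ge0 // mulr_ge0 //.
  by rewrite addr_ge0 ?sqr_ge0 // ltW.
rewrite /level_set_mass partial_sum_recl -/(level_set_mass n la).
have -> : (la < S o)%R = false by apply/negbTE; rewrite -leNgt sum_averages_origin avo; lra.
rewrite mul0r add0r.
apply: (@le_trans _ _ (2 * c ^+ 2 * sector o)); last first.
  by rewrite ler_wpM2r // ler_pM2l // lerDr ltW.
apply: (@le_trans _ _ (\sum_(s <- sons o o) 2 * c ^+ 2 * sector s)); last first.
  rewrite -mulr_sumr; apply: ler_wpM2l (sum_sector_sons o).
  by rewrite mulr_ge0 // sqr_ge0.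
rewrite mulr_suml big_seq [leRHS]big_seq; apply: ler_sum => s.
rewrite mem_sons => /andP[so /eqP spar].
have Sla : S (par s) < la by rewrite spar sum_averages_origin avo; lra.
have le_s := level_set_mass_le n so Sla.
rewrite spar sum_averages_origin avo in le_s Sla.
have den : la / 2 <= la - sector o + aa * average s.
  rewrite -[leLHS]addr0; apply: lerD; first by lra.
  by apply: mulr_ge0 => //; exact: average_ge0.
have den0 : 0 < la - sector o + aa * average s by apply: lt_le_trans den; lra.
have cs0 : 0 <= c ^+ 2 * sector s by rewrite mulr_ge0 ?sqr_ge0 ?sector_ge0.
rewrite -ler_pdivlMr //; apply: le_trans le_s _.
rewrite ler_pdivrMr // (_ : 2 * c ^+ 2 * sector s / la * _
  = c ^+ 2 * sector s * (2 / la * (la - sector o + aa * average s))); last by ring.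
rewrite ler_peMr // mulrAC ler_pdivlMr // mul1r; lra.
Qed.

End WeakType.


(** * The projector *)
Section Projector.
Variables (R : realType) (q : nat) (X : homogeneous_tree q) (o : X) (alpha : R).
Hypotheses (hq : (2 <= q)%N) (halpha : 1 < alpha).
Variable f : X -> R[i].
Hypothesis f1 : in_Lp o alpha 1 f.
Implicit Types (v x y z : X).

Local Open Scope complex_scope.

Local Notation d := (dist o).
Local Notation w := (weight o alpha).
Local Notation b := (growth q alpha).
Local Notation K := (explicit_kernel o alpha).
Local Notation norm1 := (Lp_powernorm o alpha 1 f).

Definition weighted_modulus x : R := cmod (f x) * w x.
Local Notation h := weighted_modulus.

Lemma weighted_modulus_ge0 x : 0 <= h x.
Proof. by rewrite mulr_ge0 ?cmod_ge0 // ltW ?weight_gt0. Qed.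

Lemma norm1E : norm1 = (\esum_(x in [set: X]) (h x)%:E)%E.
Proof. by apply: eq_esum => x _; rewrite powRr1 ?cmod_ge0. Qed.

Lemma norm1_fin_num : norm1 \is a fin_num.
Proof.
rewrite ge0_fin_numE //; rewrite norm1E; apply: esum_ge0 => x _.
by rewrite lee_fin weighted_modulus_ge0.
Qed.

Lemma partial_sum_le_norm1 n : partial_sum o n h o <= fine norm1.
Proof.
rewrite -lee_fin fineK ?norm1_fin_num // norm1E.
exact/partial_sum_le_esum/weighted_modulus_ge0.
Qed.

Lemma weighted_modulus_bounded : bounded_sums o h.
Proof.
exists (fine norm1) => n; apply: le_trans (partial_sum_le_norm1 n).
by apply: le_partial_sum => x; rewrite ger0_norm ?weighted_modulus_ge0.
Qed.

Lemma sector_le_norm1 : sector o h o <= fine norm1.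
Proof.
apply: limr_le; last by near=> n; exact: partial_sum_le_norm1.
exact: is_cvg_sector weighted_modulus_ge0 weighted_modulus_bounded o.
Unshelve. all: by end_near.
Qed.

Lemma kernel_pairing_le n z :
  partial_sum o n (fun x => `|K z x| * h x) o
  <= kernel_const o alpha * sum_averages o alpha h z.
Proof.
have h0 := weighted_modulus_ge0; have hb := weighted_modulus_bounded.
have b0 := growth_gt0 hq halpha.
have kc0 := ltW (kernel_const_gt0 o hq halpha).
pose y j := iter j (parent o) z.
apply: (@le_trans _ _ (partial_sum o n (fun x => kernel_const o alpha *
    (\sum_(j <- index_enum 'I_(d z).+1) b ^+ d (y j) * ((descends o (y j) x)%:R * h x))) o)).
  apply: le_partial_sum => x; have := explicit_kernel_le o hq halpha z x.
  move=> /(ler_wpM2r (h0 x))/le_trans; apply.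
  rewrite -mulrA ler_wpM2l // mulr_suml; apply: ler_sum => j _.
  by rewrite mulrA.
rewrite partial_sumZ ler_wpM2l // partial_sum_sum; apply: ler_sum => j _.
rewrite partial_sumZ partial_sum_descends -/(y j) /average weightE invrK mulrC.
by rewrite ler_wpM2r ?exprn_ge0 ?(ltW b0) // le_sector.
Qed.

Lemma cmod_projector_le z : cmod (bergman_projector o alpha f z)
  <= 2 * kernel_const o alpha * sum_averages o alpha h z.
Proof.
have mulE (r s : R) (c : R[i]) :
    r%:C * c * s%:C = (r * complex.Re c * s) +i* (r * complex.Im c * s).
  by case: c => a c; simpc.
rewrite /bergman_projector bergman_kernelE // /csum.
apply: le_trans (cmod_le _) _ => /=.
rewrite -mulrA mulr_natl mulr2n; apply: lerD; apply: norm_rsum_le => n;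
  apply: le_trans (kernel_pairing_le n z); apply: le_partial_sum => x;
  rewrite mulE /= !normrM (ger0_norm (ltW (weight_gt0 o hq halpha x))) -mulrA;
  rewrite ler_wpM2l // (ler_wpM2r (ltW (weight_gt0 o hq halpha x))) //.
  exact: Re_le_cmod.
exact: Im_le_cmod.
Qed.

End Projector.

Theorem corollary32 (R : realType) (q : nat) (hq : (2 <= q)%N)
    (X : homogeneous_tree q) (o : X) (alpha : R) (halpha : 1 < alpha) :
  exists C : R, 0 < C /\
    forall f : X -> R[i], in_Lp o alpha 1 f ->
    forall lambda : R, 0 < lambda ->
      (mu o alpha [set z | (lambda < cmod (bergman_projector o alpha f z))%R]
         <= (C / lambda)%:E * Lp_powernorm o alpha 1 f)%E.
Proof.
pose k := 2 * kernel_const o alpha.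
pose m := 2 * (total_mass o alpha + sector_ratio q alpha ^+ 2).
have k0 : 0 < k by rewrite mulr_gt0 ?kernel_const_gt0.
have m0 : 0 < m.
  by rewrite mulr_gt0 // ltr_pwDl ?sqr_ge0 ?total_mass_gt0.
exists (m * k); split=> [|f f1 lambda lambda0]; first exact: mulr_gt0.
set E := [set z | _]; pose h := weighted_modulus o alpha f.
have wE0 x : 0 <= (if x \in E then weight o alpha x else 0).
  by case: ifP => // _; rewrite ltW ?weight_gt0.
have lambdak0 : 0 < lambda / k by rewrite divr_gt0.
rewrite -(fineK (norm1_fin_num hq halpha f1)) -EFinM /mu esum_mkcond.
rewrite (eq_esum (b := fun x => (if x \in E then weight o alpha x else 0)%:E)); last first.
  by move=> x _; case: ifP.
apply: esum_le_partial_sum => // n.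
apply: (@le_trans _ _ (level_set_mass o alpha h n (lambda / k) o)).
  apply: le_partial_sum => x; case: ifPn => [|_]; last first.
    by rewrite mulr_ge0 ?ler0n // ltW ?weight_gt0.
  rewrite inE /E /= => /lt_le_trans/(_ (cmod_projector_le hq halpha f1 x)).
  by rewrite -/k -ltr_pdivrMl // mulrC => ->; rewrite mul1r.
apply: (le_trans (level_set_mass_origin hq halpha _ _ n lambdak0)).
- exact: weighted_modulus_ge0.
- exact: weighted_modulus_bounded.
rewrite -/m (_ : m * sector o h o / _ = m * k / lambda * sector o h o); last first.
  by rewrite invf_div; ring.
apply: ler_wpM2l; first by rewrite divr_ge0 // ltW // mulr_gt0.
exact: sector_le_norm1.
Qed.
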